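(* Let $G$ be a group and $(X,\pi)$ a Banach $G$-module. Assume that $\xi\in G'\cap \Delta G$ is such that the operator $I-\pi(\xi)$ is invertible in $\mathcal L(X)$. Then the cochain complex $$\{0\}\longrightarrow C^0(G,X)\overset{\partial^1}\longrightarrow C^1(G,X)\overset{\partial^2}\longrightarrow C^2(G,X)\overset{\partial^3}\longrightarrow C^3(G,X)\overset{\partial^4}\longrightarrow\cdots$$ is split exact. In other words, $B^n(G,X)=Z^n(G,X)$ and $B^n(G,X)$ is complemented in $C^n(G,X)$ for all $n\geqslant 0$.
   Context: All Banach spaces are real and groups are discrete. A Banach $G$-module is a pair $(X,\pi)$ with $X$ a Banach space and $\pi$ an action of $G$ on $X$ by bounded linear automorphisms (not necessarily isometric). $\mathcal L(X)$ is the Banach algebra of bounded linear operators on $X$. $\mathbb R G$ is the real group algebra of $G$, with $G$ identified with its canonical basis. $G'=\{\xi\in\mathbb R G: g\xi=\xi g\ \forall g\in G\}$ is the commutant of $G$ in $\mathbb R G$, and $\Delta G$ is the convex hull of $G$ in $\mathbb R G$. The action extends linearly to an algebra representation $\pi:\mathbb R G\to\mathcal L(X)$, $\pi(\sum_i t_ig_i)=\sum_i t_i\pi(g_i)$. $C^n(G,X)$ is the vector space of all maps $G^n\to X$ (with $C^0(G,X)=X$), with the topology of pointwise convergence (product topology of the norm topology on $X$). The coboundary operator $\partial^{n+1}:C^n(G,X)\to C^{n+1}(G,X)$ is $$(\partial^{n+1}\phi)(g_1,\ldots,g_{n+1})=-\pi(g_1)\phi(g_2,\ldots,g_{n+1})+(-1)^n\phi(g_1,\ldots,g_n)-\sum_{i=1}^n(-1)^i\phi(g_1,\ldots,g_{i-1},g_ig_{i+1},g_{i+2},\ldots,g_{n+1}),$$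 and $\partial^0:\{0\}\to C^0(G,X)$ is the zero map. $Z^n(G,X)=\ker\partial^{n+1}$ and $B^n(G,X)=\operatorname{range}\partial^n$. A subspace is complemented if $C^n(G,X)$ is the topological direct sum of it and a closed linear subspace, i.e. if it is the range of a continuous linear projection. *)

(* Defs.v *)
From HB Require Import structures.
From mathcomp Require Import all_boot all_order all_algebra finmap.
From mathcomp Require Import all_classical all_reals all_analysis.
(* The notations of monalg clash with those of mathcomp-analysis. *)
From mathcomp Require Import -(notations) monalg.

Set Implicit Arguments.
Unset Strict Implicit.
Unset Printing Implicit Defensive.

Import Order.TTheory GRing.Theory Num.Theory.
Import numFieldNormedType.Exports.

Local Open Scope classical_set_scope.
Local Open Scope ring_scope.

Definition group_algebra (R : realType) (G : groupType) : Type := malg G R.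

(* [monalg] puts a product on [malg K R] only when no nontrivial element of
   the monoid [K] is invertible, so the convolution product is set up here. *)
Section GroupAlgebra.
Variables (R : realType) (G : groupType).
Implicit Types (x y z : malg G R) (g h k : G) (d : {fset G}).

Definition basis_elt g : group_algebra R G := mkmalgU g 1.

Definition convol x y : malg G R :=
  \sum_(g <- msupp x) \sum_(h <- msupp y)
    mkmalgU (g * h)%g (mcoeff g x * mcoeff h y).

Lemma convolE d1 d2 x y :
  (msupp x `<=` d1)%fset -> (msupp y `<=` d2)%fset ->
  convol x y = \sum_(g <- d1) \sum_(h <- d2)
    mkmalgU (g * h)%g (mcoeff g x * mcoeff h y).
Proof.
move=> le_d1 le_d2; rewrite /convol (big_fset_incl _ le_d1) /=.
  apply/eq_bigr=> k1 _; apply/big_fset_incl => // k _ /mcoeff_outdom ->.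
  by rewrite mulr0 monalgU0.
move=> k _ /mcoeff_outdom xk.
by rewrite big1 => // k' _; rewrite xk mul0r monalgU0.
Qed.

Lemma convolUU c1 c2 g h :
  convol (mkmalgU g c1) (mkmalgU h c2) = mkmalgU (g * h)%g (c1 * c2).
Proof. by rewrite (convolE msuppU_le msuppU_le) !big_seq_fset1 !mcoeffUU. Qed.

Lemma convol1x : left_id (basis_elt 1%g) convol.
Proof.
move=> x; rewrite (convolE msuppU_le (fsubset_refl _)) big_seq_fset1.
rewrite [RHS]monalgE; apply/eq_bigr=> k _.
by rewrite mcoeffUU mul1r mul1g.
Qed.

Lemma convolx1 : right_id (basis_elt 1%g) convol.
Proof.
move=> x; rewrite (convolE (fsubset_refl _) msuppU_le).
rewrite [RHS]monalgE; apply/eq_bigr=> k _.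
by rewrite big_seq_fset1 mcoeffUU mulr1 mulg1.
Qed.

Lemma convolDl : left_distributive convol +%R.
Proof.
move=> x y z.
rewrite [in RHS](convolE (fsubsetUl _ (msupp y)) (fsubset_refl _)).
rewrite [in RHS](convolE (fsubsetUr (msupp x) _) (fsubset_refl _)).
rewrite (convolE (msuppD_le _ _) (fsubset_refl _)).
rewrite -big_split /=; apply/eq_bigr=> k1 _.
rewrite -big_split /=; apply/eq_bigr=> k2 _.
by rewrite mcoeffD mulrDl monalgUD.
Qed.

Lemma convolDr : right_distributive convol +%R.
Proof.
move=> x y z.
rewrite [in RHS](convolE (fsubset_refl _) (fsubsetUl _ (msupp z))).
rewrite [in RHS](convolE (fsubset_refl _) (fsubsetUr (msupp y) _)).
rewrite (convolE (fsubset_refl _) (msuppD_le _ _)).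
rewrite -big_split /=; apply/eq_bigr=> k1 _.
rewrite -big_split /=; apply/eq_bigr=> k2 _.
by rewrite mcoeffD mulrDr monalgUD.
Qed.

Lemma convol0x : left_zero 0 convol.
Proof. by move=> x; rewrite /convol msupp0 big_seq_fset0. Qed.

Lemma convolx0 : right_zero 0 convol.
Proof.
by move=> x; rewrite /convol big1 // => g _; rewrite msupp0 big_seq_fset0.
Qed.

Lemma convolZl c x y : c *: convol x y = convol (c *: x) y.
Proof.
rewrite (convolE (msuppZ_le c x) (fsubset_refl _)) /convol scaler_sumr.
apply/eq_bigr => g _; rewrite scaler_sumr; apply/eq_bigr => h _.
apply/malgP => k; rewrite mcoeffZ !mcoeffU mcoeffZ -mulrA.
by rewrite mulrnAr.
Qed.

Lemma convolZr c x y : c *: convol x y = convol x (c *: y).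
Proof.
rewrite (convolE (fsubset_refl _) (msuppZ_le c y)) /convol scaler_sumr.
apply/eq_bigr => g _; rewrite scaler_sumr; apply/eq_bigr => h _.
apply/malgP => k; rewrite mcoeffZ !mcoeffU mcoeffZ mulrCA.
by rewrite mulrnAr.
Qed.

Lemma convolA : associative convol.
Proof.
move=> x y z.
have suml I (r : seq I) (F : I -> malg G R) t :
    convol (\sum_(i <- r) F i) t = \sum_(i <- r) convol (F i) t.
  exact: (big_morph (convol^~ t) (fun _ _ => convolDl _ _ _) (convol0x _)).
have sumr I (r : seq I) (F : I -> malg G R) t :
    convol t (\sum_(i <- r) F i) = \sum_(i <- r) convol t (F i).
  exact: (big_morph (convol t) (fun _ _ => convolDr _ _ _) (convolx0 _)).
rewrite (monalgE x) !suml; apply/eq_bigr => k1 _.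
rewrite (monalgE y) !(suml, sumr); apply/eq_bigr => k2 _.
rewrite (monalgE z) !sumr; apply/eq_bigr => k3 _.
by rewrite !convolUU mulrA mulgA.
Qed.

Lemma basis_elt1_neq0 : basis_elt 1%g != 0 :> malg G R.
Proof. by rewrite /basis_elt monalgU_eq0 oner_eq0. Qed.

HB.instance Definition _ := GRing.Lmodule.copy (group_algebra R G) (malg G R).
HB.instance Definition _ := GRing.Zmodule_isNzRing.Build (group_algebra R G)
  convolA convol1x convolx1 convolDl convolDr basis_elt1_neq0.
HB.instance Definition _ :=
  GRing.Lmodule_isLalgebra.Build R (group_algebra R G) convolZl.
HB.instance Definition _ :=
  GRing.Lalgebra_isAlgebra.Build R (group_algebra R G) convolZr.

End GroupAlgebra.

Arguments basis_elt {R G} g.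

Section Commutant.
Variables (R : realType) (G : groupType).

Definition commutant : set (group_algebra R G) :=
  [set xi | forall g : G, basis_elt g * xi = xi * basis_elt g].

End Commutant.

Arguments commutant R G : clear implicits.

Definition convex_hull (R : realType) (E : lmodType R) (A : set E) : set E :=
  smallest (@convex_set R E) A.

Definition simplex (R : realType) (G : groupType) : set (group_algebra R G) :=
  convex_hull (range (@basis_elt R G)).

Arguments simplex R G : clear implicits.

Section BanachModule.
Variables (R : realType) (G : groupType) (X : completeNormedModType R).

Definition bounded_operator (T : X -> X) : Prop :=
  exists M : R, forall x, `|T x| <= M * `|x|.

Definition invertible_operator (T : X -> X) : Prop :=
  exists S : {linear X -> X},
    [/\ bounded_operator S, cancel T S & cancel S T].

(* Each [gaction_fun g] is an automorphism, with bounded inverse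
   [gaction_fun g^-1]. *)
Record gaction := GAction {
  gaction_fun :> G -> {linear X -> X};
  gaction_bounded : forall g, bounded_operator (gaction_fun g);
  gaction1 : forall x, gaction_fun 1%g x = x;
  gactionM : forall g h x,
    gaction_fun (g * h)%g x = gaction_fun g (gaction_fun h x) }.

Variable pi : gaction.

Definition algebra_action (xi : group_algebra R G) (x : X) : X :=
  \sum_(g <- msupp xi) mcoeff g xi *: pi g x.

Lemma algebra_action_is_linear xi : linear (algebra_action xi).
Proof.
move=> a x y; rewrite /algebra_action scaler_sumr -big_split /=.
apply: eq_bigr => g _; rewrite linearP scalerDr !scalerA.
by rewrite [a * _]mulrC.
Qed.

HB.instance Definition _ xi := GRing.isLinear.Build R X X *:%R
  (algebra_action xi) (algebra_action_is_linear xi).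

Lemma algebra_action_bounded xi : bounded_operator (algebra_action xi).
Proof.
rewrite /bounded_operator /algebra_action.
elim: (msupp xi : seq G) => [|g s [M sM]].
  by exists 0 => x; rewrite big_nil normr0 mul0r.
have [N gN] := gaction_bounded pi g.
exists (`|mcoeff g xi| * N + M) => x; rewrite big_cons mulrDl.
rewrite (le_trans (ler_normD _ _)) // lerD //.
by rewrite normrZ -mulrA ler_wpM2l.
Qed.

End BanachModule.

Section Cohomology.
Variables (R : realType) (G : groupType) (X : completeNormedModType R).
Variable pi : gaction G X.
Implicit Type n : nat.

Definition cochain n : Type := {ptws n.-tuple G -> X}.
HB.instance Definition _ n := Uniform.on (cochain n).
HB.instance Definition _ n := GRing.Lmodule.copy (cochain n) (n.-tuple G -> X).

(* With [g = (g_1, ..., g_(n+1))] and [i] counted from 0, this is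
   [(g_1, ..., g_i, g_(i+1) * g_(i+2), g_(i+3), ..., g_(n+1))]. *)
Definition merge_at n (i : 'I_n) (g : n.+1.-tuple G) : n.-tuple G :=
  [tuple if (j < i)%N then tnth g (widen_ord (leqnSn n) j)
         else if j == i then
           (tnth g (widen_ord (leqnSn n) j) * tnth g (lift ord0 j))%g
         else tnth g (lift ord0 j) | j < n].

Definition drop_first n (g : n.+1.-tuple G) : n.-tuple G :=
  [tuple tnth g (lift ord0 j) | j < n].

Definition drop_last n (g : n.+1.-tuple G) : n.-tuple G :=
  [tuple tnth g (widen_ord (leqnSn n) j) | j < n].

Definition coboundary n (phi : cochain n) : cochain n.+1 :=
  fun g => - pi (tnth g ord0) (phi (drop_first g))
           + (-1) ^+ n *: phi (drop_last g)
           - \sum_(i < n) (-1) ^+ i.+1 *: phi (merge_at i g).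

Definition cocycles n : set (cochain n) := [set phi | coboundary phi = 0].

(* [B^0] is the range of the zero map [{0} -> C^0]. *)
Definition coboundaries n : set (cochain n) :=
  match n with
  | 0 => [set 0]
  | m.+1 => range (@coboundary m)
  end.

End Cohomology.

Arguments cocycles {R G X} pi n.
Arguments coboundaries {R G X} pi n.

Definition complemented (R : realType) (V : preTopologicalLmodType R)
    (B : set V) : Prop :=
  exists P : {linear V -> V},
    [/\ continuous P, forall v, P (P v) = P v & range P = B].

(* Main.v *)
Require Import Defs.
From HB Require Import structures.
From mathcomp Require Import all_boot all_order all_algebra finmap.
From mathcomp Require Import all_classical all_reals all_analysis.
From mathcomp Require Import -(notations) monalg.
Import Order.TTheory GRing.Theory Num.Theory.
Import numFieldNormedType.Exports.
Local Open Scope classical_set_scope.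
Local Open Scope ring_scope.

Set Implicit Arguments.
Unset Strict Implicit.
Unset Printing Implicit Defensive.

(** The central element [xi] acts on the cohomology of [G] with coefficients in
    [X] both by [pi xi] and, since its coefficients sum to 1, by the identity,
    and an explicit homotopy relates the two actions.  It is the operator [K]
    which inserts [xi] at every position of the argument, with alternating
    signs: for [xi = \sum_x t_x x],
    [[
      (K phi)(g_1, ..., g_n) =
        \sum_(j <= n) (-1)^j \sum_x t_x phi(g_1, ..., g_j, x, g_(j+1), ..., g_n).
    ]]
    One has [K d + d K = 1 - pi xi], where [d] is the coboundary
    ([insertion_seq_cobound]).  The first face of the coboundary contributes
    [- pi xi] ([insertion_outer_cobound]); the other faces contribute the
    identity ([insertion_inner_cobound]), the terms in which [x] is merged with
    a neighbour cancelling in pairs because [\sum_x t_x F (a x)] equals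
    [\sum_x t_x F (x a)] when [xi] is central.

    Let [U] be the inverse of [1 - pi xi].  Centrality also makes [pi xi], hence
    [U], commute with the action of [G], so [U] commutes with [d], and [U K] is
    a contracting homotopy: [U K d + d U K = 1].  The projection is
    [P = d U K].  Its range lies in the coboundaries; these are cocycles as
    [d d = 0]; and [P] is the identity on cocycles.  So coboundaries and
    cocycles coincide, and [P] is a continuous projection onto them.

    To make inductions on the number of arguments possible, all of this is
    carried out on functions of sequences of arbitrary length, of which the
    cochains of degree [n] are the restrictions to sequences of length [n]. *)

(** * Integration against an element of the group algebra *)

Section Average.
Variables (R : realType) (G : groupType) (V : lmodType R).
Implicit Types (xi : group_algebra R G) (F : G -> V).

(** The linear extension of [F : G -> V] to the group algebra, evaluated at
    [xi]. *)
Definition average xi F : V := \sum_(g <- msupp xi) mcoeff g xi *: F g.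

Lemma averageEw xi F (d : {fset G}) : (msupp xi `<=` d)%fset ->
  average xi F = \sum_(g <- d) mcoeff g xi *: F g.
Proof.
move=> le_d; rewrite /average (big_fset_incl _ le_d) // => g _.
by move=> /mcoeff_outdom ->; rewrite scale0r.
Qed.

Lemma averageD xi1 xi2 F :
  average (xi1 + xi2) F = average xi1 F + average xi2 F.
Proof.
rewrite (averageEw _ (msuppD_le _ _)) (averageEw _ (fsubsetUl _ (msupp xi2))).
rewrite (averageEw _ (fsubsetUr (msupp xi1) _)) -big_split /=.
by apply: eq_bigr => g _; rewrite mcoeffD scalerDl.
Qed.

Lemma averageZ c xi F : average (c *: xi) F = c *: average xi F.
Proof.
rewrite (averageEw _ (msuppZ_le c xi)) /average scaler_sumr.
by apply: eq_bigr => g _; rewrite mcoeffZ scalerA.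
Qed.

Lemma average0 F : average 0 F = 0.
Proof. by rewrite /average msupp0 big_seq_fset0. Qed.

Lemma averageU g c F : average (mkmalgU g c) F = c *: F g.
Proof. by rewrite (averageEw _ msuppU_le) big_seq_fset1 mcoeffUU. Qed.

Lemma average_sum I (r : seq I) (E : I -> group_algebra R G) F :
  average (\sum_(i <- r) E i) F = \sum_(i <- r) average (E i) F.
Proof.
apply: (big_morph (average^~ F)) => [x y|]; first exact: averageD.
exact: average0.
Qed.

Lemma averageFD xi F1 F2 :
  average xi (fun x => F1 x + F2 x) = average xi F1 + average xi F2.
Proof. by rewrite -big_split; apply: eq_bigr => g _; rewrite scalerDr. Qed.

Lemma averageFZ xi c F : average xi (fun x => c *: F x) = c *: average xi F.
Proof.
rewrite /average scaler_sumr; apply: eq_bigr => g _.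
by rewrite !scalerA mulrC.
Qed.

Lemma averageFN xi F : average xi (fun x => - F x) = - average xi F.
Proof. by rewrite /average -sumrN; apply: eq_bigr => g _; rewrite scalerN. Qed.

Lemma eq_average xi F1 F2 : F1 =1 F2 -> average xi F1 = average xi F2.
Proof. by move=> eF; apply: eq_bigr => g _; rewrite eF. Qed.

Lemma average_comp xi F (U : {linear V -> V}) :
  average xi (fun x => U (F x)) = U (average xi F).
Proof. by rewrite linear_sum; apply: eq_bigr => g _; rewrite linearZ. Qed.

Lemma average_basisl a xi F :
  average (basis_elt a * xi) F = average xi (fun x => F (a * x)%g).
Proof.
rewrite -[basis_elt a * xi]/(convol (mkmalgU a 1) xi).
rewrite (convolE msuppU_le (fsubset_refl _)).
rewrite big_seq_fset1 average_sum; apply: eq_bigr => g _.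
by rewrite averageU mcoeffUU mul1r.
Qed.

Lemma average_basisr a xi F :
  average (xi * basis_elt a) F = average xi (fun x => F (x * a)%g).
Proof.
rewrite -[xi * basis_elt a]/(convol xi (mkmalgU a 1)).
rewrite (convolE (fsubset_refl _) msuppU_le).
rewrite average_sum; apply: eq_bigr => g _.
by rewrite big_seq_fset1 averageU mcoeffUU mulr1.
Qed.

Lemma average_central xi F a : commutant R G xi ->
  average xi (fun x => F (a * x)%g) = average xi (fun x => F (x * a)%g).
Proof. by move=> cxi; rewrite -average_basisl cxi average_basisr. Qed.

(** The coefficients of an element of the convex hull of [G] sum to 1: this
    holds on [G] and defines a convex set. *)
Lemma average_cst xi v : simplex R G xi -> average xi (fun=> v) = v.
Proof.
move=> /(_ [set x | average x (fun=> v) = v]); apply; split=> [x y l|].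
  rewrite !inE /= => xv yv.
  rewrite -[conv l x y]/(_ *: x + _ *: y) averageD !averageZ xv yv -scalerDl.
  by rewrite /= unstable.add_onemK scale1r.
by move=> _ [g _ <-] /=; rewrite averageU scale1r.
Qed.

End Average.

(** * The contracting homotopy on functions of finite sequences *)

Section SequenceComplex.
Variables (R : realType) (G : groupType) (X : completeNormedModType R).
Variable pi : gaction G X.
Implicit Types (f : seq G -> X) (s : seq G) (a b : G) (xi : group_algebra R G).

(** Multiply the first entry of the argument by [a] on the left.  On the empty
    sequence, [a] is dropped, so that the last face of the coboundary, which
    drops the last entry, is treated like those which merge two entries. *)
Definition absorb a f s : X :=
  if s is b :: s' then f (a * b :: s')%g else f [::].

(** All faces of the coboundary except the first one: those which multiply two
    consecutive entries, and the one which drops the last entry.  The recursion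
    fixes the first entry [a]: either [a] is merged with its successor, or the
    face concerns the remaining entries, and its sign changes. *)
Fixpoint inner_cobound f s : X :=
  if s is a :: s' then
    absorb a f s' - inner_cobound (fun u => f (a :: u)) s'
  else 0.

(** The first face of the coboundary, the only one that uses the action. *)
Definition outer_cobound f s : X := if s is a :: s' then - pi a (f s') else 0.

(** The coboundary on functions of sequences, set to 0 on the empty sequence. *)
Definition seq_cobound f s : X := outer_cobound f s + inner_cobound f s.

(** The alternating sum, over all positions of [s], of the averages against [xi]
    of [f] evaluated at [s] with a new entry inserted at that position. *)
Fixpoint insertion xi f s : X :=
  average xi (fun x => f (x :: s)) -
  (if s is a :: s' then insertion xi (fun u => f (a :: u)) s' else 0).

Lemma inner_cobound_lin c f1 f2 s :
  inner_cobound (fun u => c *: f1 u + f2 u) s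
  = c *: inner_cobound f1 s + inner_cobound f2 s.
Proof.
elim: s f1 f2 => [|a s IH] f1 f2 /=; first by rewrite scaler0 addr0.
rewrite IH scalerBr opprD addrACA; congr (_ + _).
by case: s {IH} => /=.
Qed.

Lemma seq_cobound_lin c f1 f2 s :
  seq_cobound (fun u => c *: f1 u + f2 u) s
  = c *: seq_cobound f1 s + seq_cobound f2 s.
Proof.
rewrite /seq_cobound inner_cobound_lin scalerDr addrACA; congr (_ + _).
case: s => [|a s] /=; first by rewrite scaler0 addr0.
by rewrite linearP opprD scalerN.
Qed.

Lemma insertion_lin xi c f1 f2 s :
  insertion xi (fun u => c *: f1 u + f2 u) s
  = c *: insertion xi f1 s + insertion xi f2 s.
Proof.
elim: s f1 f2 => [|a s IH] f1 f2 /=; rewrite averageFD averageFZ.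
  by rewrite !subr0.
by rewrite IH scalerBr opprD addrACA.
Qed.

Lemma inner_coboundB f1 f2 s :
  inner_cobound (fun u => f1 u - f2 u) s
  = inner_cobound f1 s - inner_cobound f2 s.
Proof.
rewrite addrC -scaleN1r -inner_cobound_lin; congr inner_cobound.
by apply/funext => u; rewrite scaleN1r addrC.
Qed.

Lemma insertionB xi f1 f2 s :
  insertion xi (fun u => f1 u - f2 u) s
  = insertion xi f1 s - insertion xi f2 s.
Proof.
rewrite addrC -scaleN1r -insertion_lin; congr insertion.
by apply/funext => u; rewrite scaleN1r addrC.
Qed.

Lemma insertion0 xi s : insertion xi (fun=> 0) s = 0.
Proof. by have := insertionB xi (fun=> 0) (fun=> 0) s; rewrite !subrr. Qed.

Lemma seq_cobound0 s : seq_cobound (fun=> 0) s = 0.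
Proof.
have := seq_cobound_lin (-1) (fun=> 0) (fun=> 0) s.
by rewrite scaler0 addr0 scaleN1r addNr.
Qed.

Lemma inner_cobound_average xi (F : G -> seq G -> X) s :
  inner_cobound (fun u => average xi (F^~ u)) s
  = average xi (fun x => inner_cobound (F x) s).
Proof.
elim: s F => [|a s IH] F /=.
  by apply/esym/big1 => g _; rewrite scaler0.
rewrite averageFD averageFN -IH; congr (_ - _).
by case: s {IH}.
Qed.

Lemma inner_cobound_comp (U : {linear X -> X}) f s :
  inner_cobound (fun u => U (f u)) s = U (inner_cobound f s).
Proof.
elim: s f => [|a s IH] f /=; first by rewrite linear0.
by rewrite IH linearB; case: s {IH}.
Qed.

Lemma insertion_comp xi (U : {linear X -> X}) f s :
  insertion xi (fun u => U (f u)) s = U (insertion xi f s).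
Proof.
elim: s f => [|a s IH] f /=; rewrite average_comp; first by rewrite !subr0.
by rewrite IH linearB.
Qed.

Lemma seq_cobound_comp (U : {linear X -> X}) f s :
  (forall g x, U (pi g x) = pi g (U x)) ->
  seq_cobound (fun u => U (f u)) s = U (seq_cobound f s).
Proof.
move=> Upi; rewrite /seq_cobound inner_cobound_comp linearD; congr (_ + _).
by case: s => [|a s] /=; rewrite ?linear0 // linearN Upi.
Qed.

Lemma eq_inner_cobound f1 f2 s :
  (forall u, (size u).+1 = size s -> f1 u = f2 u) ->
  inner_cobound f1 s = inner_cobound f2 s.
Proof.
elim: s f1 f2 => [//|a s IH] f1 f2 ef /=; congr (_ - _).
  by case: s {IH} ef => [|b s] ef /=; apply: ef.
by apply: IH => u us; apply: ef; rewrite /= us.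
Qed.

Lemma eq_seq_cobound f1 f2 s :
  (forall u, (size u).+1 = size s -> f1 u = f2 u) ->
  seq_cobound f1 s = seq_cobound f2 s.
Proof.
move=> ef; congr (_ + _); last exact: eq_inner_cobound.
by case: s ef => [//|a s] ef /=; rewrite ef.
Qed.

Lemma eq_insertion xi f1 f2 s :
  (forall u, size u = (size s).+1 -> f1 u = f2 u) ->
  insertion xi f1 s = insertion xi f2 s.
Proof.
elim: s f1 f2 => [|a s IH] f1 f2 ef /=; congr (_ - _).
- by apply: eq_average => x; apply: ef.
- by apply: eq_average => x; apply: ef.
- by apply: IH => u us; apply: ef; rewrite /= us.
Qed.

Lemma inner_cobound_absorb a f s :
  inner_cobound (absorb a f) s = absorb a (inner_cobound f) s.
Proof. by case: s => [|b [|c s]] //=; rewrite mulgA. Qed.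

Lemma inner_cobound_sq f s : inner_cobound (inner_cobound f) s = 0.
Proof.
elim: s f => [//|a s IH] f /=.
by rewrite inner_coboundB IH inner_cobound_absorb subr0 subrr.
Qed.

Lemma inner_outer_cobound f s :
  inner_cobound (outer_cobound f) s + outer_cobound (inner_cobound f) s
  = - outer_cobound (outer_cobound f) s.
Proof.
case: s => [|a [|b s]] /=; first by rewrite addr0 oppr0.
  by rewrite !(linear0 (pi a), oppr0, addr0).
have /= -> := inner_cobound_comp (GRing.opp \o pi a) f (b :: s).
by rewrite !opprK addrK gactionM linearN.
Qed.

Lemma seq_cobound_sq f s : seq_cobound (seq_cobound f) s = 0.
Proof.
have -> : seq_cobound (seq_cobound f) s =
    seq_cobound (outer_cobound f) s + seq_cobound (inner_cobound f) s.
  rewrite -[X in X + _]scale1r -seq_cobound_lin.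
  by apply: eq_seq_cobound => u _; rewrite scale1r.
rewrite /seq_cobound inner_cobound_sq addr0 -addrA inner_outer_cobound.
by rewrite subrr.
Qed.

(** The only use of centrality in the homotopy: an entry inserted after [a] and
    absorbed by it may be replaced by one inserted before [a] and absorbing
    it. *)
Lemma insertion_absorb xi a f s : commutant R G xi ->
  insertion xi (absorb a f) s
    + average xi (fun x => absorb a (fun u => f (x :: u)) s)
  = absorb a (insertion xi f) s + average xi (fun x => f (x * a :: s)%g).
Proof.
move=> cxi; rewrite -(average_central (fun y => f (y :: s))) //.
case: s => [|b s] /=; first by rewrite !subr0 addrC.
by rewrite addrAC [X in X - _]addrC addrAC.
Qed.

(** Without the first face, [insertion] is a contracting homotopy. *)
Lemma insertion_inner_cobound xi f s : commutant R G xi -> simplex R G xi ->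
  insertion xi (inner_cobound f) s + inner_cobound (insertion xi f) s = f s.
Proof.
move=> cxi sxi; elim: s f => [|a s IH] f.
  rewrite /= subr0 addr0 -[RHS](average_cst (f [::]) sxi).
  by apply: eq_average => x; rewrite subr0.
rewrite [insertion _ _ _]/= [inner_cobound (insertion _ _) _]/=.
set fa := fun u => f (a :: u).
have -> : average xi (fun x => absorb x f (a :: s)
      - inner_cobound (fun u => f (x :: u)) (a :: s))
    = average xi (fun x => f (x * a :: s)%g)
      - average xi (fun x => absorb a (fun u => f (x :: u)) s)
      + average xi (fun x => inner_cobound (fun u => f (x :: a :: u)) s).
  rewrite -averageFN -!averageFD; apply: eq_average => x /=.
  by rewrite opprB addrA addrAC.
rewrite insertionB inner_coboundB inner_cobound_average.
rewrite (canRL (addrK _) (insertion_absorb a f s cxi)).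
rewrite -[f (a :: s)]/(fa s) -(IH fa) !(opprB, opprD) !addrA.
(* Bring forward the two terms given by the induction hypothesis; the other
   eight cancel in pairs. *)
by rewrite [LHS](ACl (4*9*1*7*3*10*8*6*5*2))%AC /= !addrK.
Qed.

Lemma insertion_outer_cobound xi f s :
  insertion xi (outer_cobound f) s + outer_cobound (insertion xi f) s
  = - algebra_action pi xi (f s).
Proof.
case: s => [|a s] /=.
  by rewrite subr0 addr0 averageFN.
rewrite averageFN.
have /= -> := insertion_comp xi (GRing.opp \o pi a) f s.
by rewrite opprK addrK.
Qed.

(** The homotopy formula between the identity and the action of [xi]. *)
Lemma insertion_seq_cobound xi f s : commutant R G xi -> simplex R G xi ->
  insertion xi (seq_cobound f) s + seq_cobound (insertion xi f) s
  = f s - algebra_action pi xi (f s).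
Proof.
move=> cxi sxi.
have -> : insertion xi (seq_cobound f) s
    = insertion xi (outer_cobound f) s + insertion xi (inner_cobound f) s.
  rewrite -[X in _ = X + _]scale1r -insertion_lin; congr insertion.
  by apply/funext => u; rewrite scale1r.
by rewrite addrACA insertion_outer_cobound insertion_inner_cobound // addrC.
Qed.

End SequenceComplex.

(** * Cochains as restrictions of functions of finite sequences *)

Section Cochains.
Variables (R : realType) (G : groupType) (X : completeNormedModType R).
Variable pi : gaction G X.
Implicit Types (f : seq G -> X) (n : nat).

(** The cochain of degree [n] given by a function of sequences. *)
Definition restrict n f : cochain G X n := fun g => f g.
Arguments restrict n f : clear implicits.

(** The extension of a cochain by 0 to sequences of other lengths. *)
Definition extend n (phi : cochain G X n) : seq G -> X :=
  fun s => oapp phi 0 (insub s : option (n.-tuple G)).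

Lemma extendE n (phi : cochain G X n) (g : n.-tuple G) : extend phi g = phi g.
Proof. by rewrite /extend valK. Qed.

Lemma extendK n (phi : cochain G X n) : restrict n (extend phi) = phi.
Proof. by apply/funext => g; exact: extendE. Qed.

Lemma widen_ord0 n (le_n : (n.+1 <= n.+2)%N) :
  widen_ord le_n ord0 = ord0.
Proof. exact: val_inj. Qed.

Lemma widen_ord_lift n (le_n : (n <= n.+1)%N) (le_n1 : (n.+1 <= n.+2)%N) k :
  widen_ord le_n1 (lift ord0 k) = lift ord0 (widen_ord le_n k).
Proof. exact: val_inj. Qed.

Lemma drop_first_cons n a (t : n.-tuple G) : drop_first [tuple of a :: t] = t.
Proof. by apply: eq_from_tnth => j; rewrite tnth_mktuple tnthS. Qed.

Lemma drop_last_cons n a (t : n.+1.-tuple G) :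
  drop_last [tuple of a :: t] = [tuple of a :: drop_last t].
Proof.
apply: eq_from_tnth => j; rewrite tnth_mktuple.
have [k ->|->] := unliftP ord0 j; last by rewrite widen_ord0 !tnth0.
by rewrite (widen_ord_lift (leqnSn n)) !tnthS tnth_mktuple.
Qed.

Lemma merge_at_ord0 n a b (t : n.-tuple G) :
  merge_at ord0 [tuple of a :: [tuple of b :: t]] = [tuple of (a * b)%g :: t].
Proof.
apply: eq_from_tnth => j; rewrite tnth_mktuple ltn0.
have [k ->|->] := unliftP ord0 j; last by rewrite eqxx widen_ord0 tnthS !tnth0.
by rewrite !tnthS.
Qed.

Lemma merge_at_lift n a (i : 'I_n) (t : n.+1.-tuple G) :
  merge_at (lift ord0 i) [tuple of a :: t] = [tuple of a :: merge_at i t].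
Proof.
apply: eq_from_tnth => j; rewrite tnth_mktuple.
have [k ->|->] := unliftP ord0 j; last by rewrite widen_ord0 !tnth0.
rewrite (widen_ord_lift (leqnSn n)) !tnthS tnth_mktuple.
by rewrite (inj_eq (@lift_inj _ _)).
Qed.

(** The recursive definition agrees with the explicit alternating sum. *)
Lemma inner_cobound_tuple f n (g : n.+1.-tuple G) :
  inner_cobound f g = (-1) ^+ n *: f (drop_last g)
    - \sum_(i < n) (-1) ^+ i.+1 *: f (merge_at i g).
Proof.
elim: n f g => [|n IH] f g; case/tupleP: g => a t.
  rewrite [t]tuple0 big_ord0 expr0 scale1r subr0 [LHS]subr0.
  by congr f; rewrite (tuple0 (drop_last _)).
have -> : inner_cobound f [tuple of a :: t]
    = absorb a f t - inner_cobound (fun u => f (a :: u)) t by [].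
rewrite IH drop_last_cons big_ord_recl; case/tupleP: t => b u.
rewrite merge_at_ord0 !opprB opprD.
under [in RHS]eq_bigr => i _ do rewrite merge_at_lift.
rewrite exprS mulN1r scaleNr expr1 scaleN1r opprK [RHS]addrCA.
congr (_ + _); rewrite addrC; congr (_ + _); rewrite -sumrN.
by apply: eq_bigr => i _; rewrite [in RHS]exprS mulN1r scaleNr opprK.
Qed.

Lemma coboundary_restrict n f :
  coboundary pi (restrict n f) = restrict n.+1 (seq_cobound pi f).
Proof.
apply/funext => g; rewrite /coboundary -addrA.
rewrite /restrict -inner_cobound_tuple /seq_cobound.
by case/tupleP: g => a t; rewrite drop_first_cons.
Qed.

Lemma extend_lin n c (phi psi : cochain G X n) s :
  extend (c *: phi + psi) s = c *: extend phi s + extend psi s.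
Proof. by rewrite /extend; case: insub => //=; rewrite scaler0 addr0. Qed.

Lemma coboundary0 n : coboundary pi (0 : cochain G X n) = 0.
Proof.
have -> : (0 : cochain G X n) = restrict n (fun=> 0) by [].
by rewrite coboundary_restrict; apply/funext => g; exact: seq_cobound0.
Qed.

Lemma coboundary_coboundary n (phi : cochain G X n) :
  coboundary pi (coboundary pi phi) = 0.
Proof.
rewrite -(extendK phi) !coboundary_restrict.
by apply/funext => g; rewrite /restrict seq_cobound_sq.
Qed.

Lemma bounded_operator_continuous (U : {linear X -> X}) :
  bounded_operator U -> continuous U.
Proof.
move=> [M UM]; apply: bounded_linear_continuous; apply/linear_boundedP.
exists M; split=> [|r Mr x]; first exact: num_real.
by rewrite (le_trans (UM x)) // ler_wpM2r // ltW.
Qed.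

Section Continuity.
Variables (T : topologicalType) (F : T -> seq G -> X).
Implicit Types s : seq G.

Lemma insertion_continuous xi s : (forall u, continuous (F^~ u)) ->
  continuous (fun t => insertion xi (F t) s).
Proof.
have avg_cont (E : T -> G -> X) : (forall x, continuous (E^~ x)) ->
    continuous (fun t => average xi (E t)).
  move=> cE; apply: continuous_big => [|g _ t].
    exact: add_continuous.
  by apply: cvgZl_tmp; exact: cE.
move=> cF; rewrite /=; elim: s F cF => [|a s IH] E cE t /=.
  by apply: cvgB; [exact: avg_cont|exact: cvg_cst].
apply: cvgB; first exact: (avg_cont (fun t x => E t (x :: a :: s))).
exact: (IH (fun t u => E t (a :: u))).
Qed.

Lemma seq_cobound_continuous s : (forall u, continuous (F^~ u)) ->
  continuous (fun t => seq_cobound pi (F t) s).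
Proof.
move=> cF t; apply: cvgD.
  case: s => [|a s] /=; first exact: cvg_cst.
  apply: cvgN; apply: continuous_cvg; last exact: cF.
  by apply: bounded_operator_continuous; exact: gaction_bounded.
move: t; elim: s F cF => [|a s IH] E cE t /=; first exact: cvg_cst.
apply: cvgB; last exact: (IH (fun t u => E t (a :: u))).
by case: s {IH} => [|b s] /=; exact: cE.
Qed.

End Continuity.

Lemma extend_continuous n s :
  continuous (fun phi : cochain G X n => extend phi s).
Proof.
rewrite /extend; case: insub => [g|] /=; last exact: cst_continuous.
exact: (@proj_continuous _ (fun=> X) g).
Qed.

Lemma continuous_restrict (T : topologicalType) n (F : T -> seq G -> X) :
  (forall s, continuous (F^~ s)) -> continuous (fun t => restrict n (F t)).
Proof.
move=> cF t.
(* The topology put on the index set plays no role in pointwise convergence. *)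
apply/(@pointwise_cvgP (discrete_topology (n.-tuple G)) X) => g.
exact: cF.
Qed.

End Cochains.

Arguments restrict {R G X} n f.

(** * The projection onto the coboundaries *)

Section Projection.
Variables (R : realType) (G : groupType) (X : completeNormedModType R).
Variables (pi : gaction G X) (xi : group_algebra R G) (U : {linear X -> X}).
Implicit Type n : nat.

(** The operator [d U K], with [d] the coboundary and [K] the insertion of [xi];
    [U] is meant to be the inverse of [1 - pi xi].  It is 0 in degree 0. *)
Definition cobound_proj n (phi : cochain G X n) : cochain G X n :=
  restrict n (seq_cobound pi (fun s => U (insertion xi (extend phi) s))).

Lemma cobound_proj_is_linear n : linear (@cobound_proj n).
Proof.
move=> c phi psi; apply/funext => g.
(* The linear operations on cochains are pointwise. *)
transitivity (c *: cobound_proj phi g + cobound_proj psi g); last by [].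
rewrite /cobound_proj /restrict -seq_cobound_lin; congr seq_cobound.
apply/funext => s; rewrite -linearP -insertion_lin; congr (U (insertion _ _ _)).
by apply/funext => u; rewrite extend_lin.
Qed.

HB.instance Definition _ n := GRing.isLinear.Build R (cochain G X n)
  (cochain G X n) *:%R (@cobound_proj n) (@cobound_proj_is_linear n).

Lemma cobound_proj_continuous n :
  bounded_operator U -> continuous (@cobound_proj n).
Proof.
move=> bU.
pose E (phi : cochain G X n) u : X := U (insertion xi (extend phi) u).
have cE u : continuous (E^~ u).
  have cI : continuous (fun phi : cochain G X n => insertion xi (extend phi) u).
    apply: (insertion_continuous (F := fun phi => extend phi)) => v.
    exact: extend_continuous.
  move=> phi.
  have cU := bounded_operator_continuous bU.
  exact: (continuous_comp (cI phi) (cU _)).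
apply: continuous_restrict => s.
exact: (seq_cobound_continuous cE).
Qed.

Lemma cobound_proj_coboundaries n (phi : cochain G X n) :
  coboundaries pi n (cobound_proj phi).
Proof.
case: n phi => [|n] phi /=.
  by apply/funext => g; rewrite /cobound_proj /restrict tuple0 [LHS]addr0.
exists (restrict n (fun s => U (insertion xi (extend phi) s))) => //.
exact: coboundary_restrict.
Qed.

Hypotheses (cxi : commutant R G xi) (sxi : simplex R G xi).
Hypotheses (UK : cancel (idfun \- algebra_action pi xi) U)
  (KU : cancel U (idfun \- algebra_action pi xi)).

(** Since [xi] is central, its action commutes with that of [G]. *)
Lemma algebra_action_central g x :
  algebra_action pi xi (pi g x) = pi g (algebra_action pi xi x).
Proof.
rewrite -[RHS]average_comp -[LHS]/(average xi (fun h => pi h (pi g x))).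
under eq_average => h do rewrite -gactionM.
under [RHS]eq_average => h do rewrite -gactionM.
by rewrite (average_central (fun h => pi h x)).
Qed.

(** Hence so does the inverse of [1 - pi xi]. *)
Lemma inverse_equivariant g x : U (pi g x) = pi g (U x).
Proof. by rewrite -{1}(KU x) /= linearB -algebra_action_central UK. Qed.

(** On a cocycle [phi], the homotopy formula reads
    [d K phi = (1 - pi xi) phi]. *)
Lemma cobound_proj_cocycle n (phi : cochain G X n) :
  cocycles pi n phi -> cobound_proj phi = phi.
Proof.
rewrite /cocycles /= -{1}(extendK phi) coboundary_restrict => dphi0.
apply/funext => g; rewrite /cobound_proj /restrict.
rewrite (seq_cobound_comp _ _ inverse_equivariant) -[RHS]extendE -[RHS]UK /=.
rewrite -(insertion_seq_cobound pi _ _ cxi sxi).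
have -> : insertion xi (seq_cobound pi (extend phi)) g = 0.
  rewrite -(insertion0 X xi g); apply: eq_insertion => u /eqP.
  rewrite size_tuple => su.
  by have /(congr1 (@^~ (Tuple su))) := dphi0.
by rewrite add0r.
Qed.

End Projection.

Theorem theorem1p2 (R : realType) (G : groupType)
    (X : completeNormedModType R) (pi : gaction G X)
    (xi : group_algebra R G)
    (xi_mem : xi \in commutant R G `&` simplex R G)
    (xi_inv : invertible_operator (idfun \- algebra_action pi xi)) :
  forall n : nat,
    coboundaries pi n = cocycles pi n /\ complemented (coboundaries pi n).
Proof.
move: xi_mem; rewrite inE => -[cxi sxi].
have [U [bU UK KU]] := xi_inv; move=> n.
have BZ : coboundaries pi n `<=` cocycles pi n.
  case: n => [|n] phi /=; first by move=> ->; exact: coboundary0.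
  by move=> [psi _ <-]; exact: coboundary_coboundary.
have PZ phi : cocycles pi n phi -> cobound_proj pi xi U phi = phi.
  exact: cobound_proj_cocycle.
have PB phi : coboundaries pi n (cobound_proj pi xi U phi).
  exact: cobound_proj_coboundaries.
have ZB : cocycles pi n `<=` coboundaries pi n by move=> phi /PZ <-.
split; first exact/seteqP.
exists (@cobound_proj R G X pi xi U n :
          {linear cochain G X n -> cochain G X n}); split.
- exact: cobound_proj_continuous.
- by move=> phi; apply/PZ/BZ/PB.
- apply/seteqP; split=> [_ [phi _ <-]|phi Bphi]; first exact: PB.
  by exists phi => //; exact/PZ/BZ.
Qed.
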